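(* Let $A\subset\mathbb{R}^m$ and $B\subset\mathbb{R}^n$ be unbounded semialgebraic subsets. If $A$ and $B$ are bi-Lipschitz homeomorphic at infinity, then their tangent cones at infinity $C_\infty(A)$ and $C_\infty(B)$ are bi-Lipschitz homeomorphic.
   Context: Subsets carry the Euclidean induced metric. $A$ and $B$ are bi-Lipschitz homeomorphic at infinity if there exist compact sets $K\subset\mathbb{R}^m$, $\widetilde K\subset\mathbb{R}^n$ and a bi-Lipschitz homeomorphism $A\setminus K\to B\setminus\widetilde K$ (Lipschitz with Lipschitz inverse). For an unbounded $X\subset\mathbb{R}^m$, a set $E$ is a tangent cone of $X$ at infinity if there exist positive reals $t_j\to+\infty$ and $D\subset\mathbb{S}^{m-1}$ with $D$ the Hausdorff limit of $\frac{1}{t_j}(X\cap\{\|x\|=t_j\})$ and $E=\{tv:v\in D,t\ge0\}$. An unbounded semialgebraic set has a unique tangent cone at infinity, denoted $C_\infty(X)$. *)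

(* Defs.v *)
From Stdlib Require Import Reals Lra List.
Open Scope R_scope.

(* Points of R^m are represented as functions nat -> R vanishing at indices >= m. *)
Definition pt := nat -> R.
Definition in_Rm (m : nat) (x : pt) : Prop := forall i, (m <= i)%nat -> x i = 0.

Fixpoint sumsq (m : nat) (x : pt) : R :=
  match m with
  | O => 0
  | S k => sumsq k x + x k * x k
  end.

Definition norm (m : nat) (x : pt) : R := sqrt (sumsq m x).
Definition dist (m : nat) (x y : pt) : R := norm m (fun i => x i - y i).

Inductive poly : Type :=
| PConst : R -> poly
| PVar : nat -> poly
| PAdd : poly -> poly -> poly
| PMul : poly -> poly -> poly.

Fixpoint peval (p : poly) (x : pt) : R :=
  match p with
  | PConst c => c
  | PVar i => x i
  | PAdd p q => peval p x + peval q x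
  | PMul p q => peval p x * peval q x
  end.

Inductive saf : Type :=
| FPos : poly -> saf
| FZero : poly -> saf
| FNot : saf -> saf
| FAnd : saf -> saf -> saf
| FOr : saf -> saf -> saf.

Fixpoint holds (f : saf) (x : pt) : Prop :=
  match f with
  | FPos p => peval p x > 0
  | FZero p => peval p x = 0
  | FNot g => ~ holds g x
  | FAnd g h => holds g x /\ holds h x
  | FOr g h => holds g x \/ holds h x
  end.

Definition semialgebraic (m : nat) (S : pt -> Prop) : Prop :=
  exists f : saf, forall x, S x <-> (in_Rm m x /\ holds f x).

Definition unbounded (m : nat) (S : pt -> Prop) : Prop :=
  forall M : R, exists x, S x /\ norm m x > M.

Definition open_in_Rm (m : nat) (U : pt -> Prop) : Prop :=
  forall x, U x -> in_Rm m x /\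
    exists r, r > 0 /\ forall y, in_Rm m y -> dist m x y < r -> U y.

Definition compact_in_Rm (m : nat) (K : pt -> Prop) : Prop :=
  (forall x, K x -> in_Rm m x) /\
  forall (I : Type) (U : I -> pt -> Prop),
    (forall i, open_in_Rm m (U i)) ->
    (forall x, K x -> exists i, U i x) ->
    exists l : list I, forall x, K x -> exists i, In i l /\ U i x.

Definition closed_in_Rm (m : nat) (S : pt -> Prop) : Prop :=
  (forall x, S x -> in_Rm m x) /\
  forall x, in_Rm m x ->
    (forall eps, eps > 0 -> exists y, S y /\ dist m x y < eps) -> S x.

Definition bilip_homeomorphic (m n : nat) (X Y : pt -> Prop) : Prop :=
  exists (f g : pt -> pt) (L : R),
    L > 0 /\
    (forall x, X x -> Y (f x)) /\
    (forall y, Y y -> X (g y)) /\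
    (forall x, X x -> g (f x) = x) /\
    (forall y, Y y -> f (g y) = y) /\
    (forall x x', X x -> X x' -> dist n (f x) (f x') <= L * dist m x x') /\
    (forall y y', Y y -> Y y' -> dist m (g y) (g y') <= L * dist n y y').

Definition bilip_at_infinity (m n : nat) (A B : pt -> Prop) : Prop :=
  exists K K' : pt -> Prop,
    compact_in_Rm m K /\ compact_in_Rm n K' /\
    bilip_homeomorphic m n (fun x => A x /\ ~ K x) (fun y => B y /\ ~ K' y).

Definition hausdorff_limit (m : nat) (Dj : nat -> pt -> Prop) (D : pt -> Prop) : Prop :=
  forall eps, eps > 0 -> exists J, forall j, (J <= j)%nat ->
    (forall x, Dj j x -> exists y, D y /\ dist m x y < eps) /\
    (forall y, D y -> exists x, Dj j x /\ dist m x y < eps).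

Definition scaled_slice (m : nat) (X : pt -> Prop) (t : R) : pt -> Prop :=
  fun y => exists x, X x /\ norm m x = t /\ forall i, y i = / t * x i.

Definition unit_sphere (m : nat) : pt -> Prop :=
  fun v => in_Rm m v /\ norm m v = 1.

Definition tangent_cone_at_infinity (m : nat) (X E : pt -> Prop) : Prop :=
  exists (t : nat -> R) (D : pt -> Prop),
    (forall j, t j > 0) /\
    (forall M, exists J, forall j, (J <= j)%nat -> t j > M) /\
    (forall v, D v -> unit_sphere m v) /\
    closed_in_Rm m D /\
    hausdorff_limit m (fun j => scaled_slice m X (t j)) D /\
    (forall x, E x <-> exists s v, 0 <= s /\ D v /\ forall i, x i = s * v i).

(* Main.v *)
(* The tangent cone does not depend on the sequence of radii: by quantifier
   elimination, the set of radii [t] for which the slice of [A] at radius [t]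
   passes near a direction [v] is a semialgebraic subset of the line, so it
   either contains or misses a neighbourhood of infinity.  Hence each [v] in the
   cone is a limit of [x_k / k] with [x_k] in [A], and conversely every cluster
   point of such dilated sequences is in the cone.  Given a bi-Lipschitz [f]
   outside compact sets, fix a non-principal ultrafilter on the naturals and
   send [v] to the ultralimit of [f x_k / k], a bounded sequence.  The Lipschitz
   estimates pass to the limit, so this is a Lipschitz map of cones, independent
   of the choice of [x_k], and the map obtained from the inverse of [f] is its
   inverse.  Using an ultrafilter makes the Arzela-Ascoli extraction of a
   subsequence unnecessary. *)
From Stdlib Require Import Reals Lra Lia Classical ClassicalEpsilon.
From Stdlib Require Import FunctionalExtensionality.
From mathcomp Require Import all_boot all_order all_algebra.
From mathcomp Require Import filter polyrcf ordered_qelim Rstruct.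
From mathcomp Require qe_rcf.
Require Import Defs.

Import Order.TTheory GRing.Theory Num.Theory.
Open Scope R_scope.

(** * Properties of a real variable that are eventually constant at infinity *)

Definition decided_at_infinity (P : R -> Prop) : Prop :=
  exists M, (forall t, M < t -> P t) \/ (forall t, M < t -> ~ P t).

(** Asking for the equivalence at positive [t] only allows inequalities between distances and
    multiples of [t] to be squared later on. *)
Lemma decided_iff (P Q : R -> Prop) :
  (forall t, 0 < t -> (P t <-> Q t)) ->
  decided_at_infinity P -> decided_at_infinity Q.
Proof.
intros HPQ [M HM]; exists (Rmax M 0).
assert (Hmax : forall t, Rmax M 0 < t -> M < t /\ 0 < t).
{ intros t Ht; pose proof (Rmax_l M 0); pose proof (Rmax_r M 0); lra. }
destruct HM as [HM | HM]; [left | right]; intros t Ht;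
  destruct (Hmax t Ht) as [H1 H2]; specialize (HM t H1); specialize (HPQ t H2);
  tauto.
Qed.

Lemma decided_const (P : Prop) : decided_at_infinity (fun _ => P).
Proof. by exists 0; case: (classic P); [left | right]. Qed.

Lemma decided_and (P Q : R -> Prop) :
  decided_at_infinity P -> decided_at_infinity Q ->
  decided_at_infinity (fun t => P t /\ Q t).
Proof.
intros [M HM] [N HN]; exists (Rmax M N).
assert (Hmax : forall t, Rmax M N < t -> M < t /\ N < t).
{ intros t Ht; pose proof (Rmax_l M N); pose proof (Rmax_r M N); lra. }
destruct HM as [HM | HM], HN as [HN | HN]; [left | right | right | right];
  intros t Ht; destruct (Hmax t Ht) as [H1 H2];
  specialize (HM t H1); specialize (HN t H2); tauto.
Qed.

Lemma decided_not (P : R -> Prop) :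
  decided_at_infinity P -> decided_at_infinity (fun t => ~ P t).
Proof. by case=> M [HM | HM]; exists M; [right | left] => t /HM; tauto. Qed.

Lemma decided_or (P Q : R -> Prop) :
  decided_at_infinity P -> decided_at_infinity Q ->
  decided_at_infinity (fun t => P t \/ Q t).
Proof.
move=> /decided_not dP /decided_not dQ.
by apply: decided_iff (decided_not _ (decided_and _ _ dP dQ)) => t _; tauto.
Qed.

(** * Definable subsets of the line, by quantifier elimination *)

Section Definable.
Local Open Scope ring_scope.

(** Beyond the Cauchy bound on its roots, a nonzero polynomial keeps the sign of its leading
    coefficient. *)
Lemma poly_pos_decided (p : {poly R}) :
  decided_at_infinity (fun t => 0 < p.[t]).
Proof.
have [->|p0] := eqVneq p 0.
  by exists 0%R; right=> t _; rewrite horner0 ltxx.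
exists (polyrcf.cauchy_bound p).
have sgE t : Rlt (polyrcf.cauchy_bound p) t -> Num.sg p.[t] = sgp_pinfty p.
  move=> /RltP /ltW ht; apply: (sgp_pinftyP (ge_cauchy_bound p0)).
  by rewrite in_itv /= ht.
by have [sp|sp] := boolP (sgp_pinfty p == 1); [left|right] => t /sgE e;
  rewrite -sgr_cp0 e; [|apply/negP].
Qed.

Lemma rterm_horner (e : seq R) (i : nat) (u : GRing.term R) : GRing.rterm u ->
  exists p : {poly R}, forall t, GRing.eval (set_nth 0 e i t) u = p.[t].
Proof.
elim: u => //=.
- move=> j _; exists (if j == i then 'X else (e`_j)%:P) => t.
  by rewrite nth_set_nth /=; case: eqP; rewrite ?hornerX ?hornerC.
- by move=> c _; exists c%:P => t; rewrite hornerC.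
- by move=> n _; exists n%:R%:P => t; rewrite hornerC.
- move=> u IHu v IHv /andP[/IHu[p Hp] /IHv[q Hq]].
  by exists (p + q) => t; rewrite hornerD Hp Hq.
- by move=> u IHu /IHu[p Hp]; exists (- p) => t; rewrite hornerN Hp.
- by move=> u IHu n /IHu[p Hp]; exists (p *+ n) => t; rewrite hornerMn Hp.
- move=> u IHu v IHv /andP[/IHu[p Hp] /IHv[q Hq]].
  by exists (p * q) => t; rewrite hornerM Hp Hq.
- by move=> u IHu n /IHu[p Hp]; exists (p ^+ n) => t; rewrite horner_exp Hp.
Qed.

(** An atom compares two polynomials in [t], so it depends on the sign of their difference; an
    equality is the failure of both strict inequalities. *)
Lemma qf_formula_decided (e : seq R) (i : nat) (f : ord.formula R) :
  ord.qf_form f -> ord.rformula f ->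
  decided_at_infinity (fun t => ord.qf_eval (set_nth 0 e i t) f).
Proof.
have lt_decided u v : GRing.rterm u -> GRing.rterm v ->
    decided_at_infinity (fun t =>
      GRing.eval (set_nth 0 e i t) u < GRing.eval (set_nth 0 e i t) v).
  move=> /(rterm_horner e i)[p Hp] /(rterm_horner e i)[q Hq].
  apply: decided_iff (poly_pos_decided (q - p)) => t _.
  by rewrite Hp Hq hornerD hornerN subr_gt0.
elim: f => //=.
- by move=> b _ _; apply: decided_const.
- move=> u v _ /andP[ru rv].
  apply: decided_iff (decided_not _ (decided_or _ _
    (lt_decided _ _ ru rv) (lt_decided _ _ rv ru))) => t _.
  by case: ltgtP => _; split=> // H; [case: H; left|case: H; right|case].
- by move=> u v _ /andP[ru rv]; apply: lt_decided.
- move=> u v _ /andP[ru rv].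
  apply: decided_iff (decided_not _ (lt_decided _ _ rv ru)) => t _.
  by rewrite leNgt; split=> /negP.
- move=> f IHf g IHg /andP[qf qg] /andP[rf rg].
  apply: decided_iff (decided_and _ _ (IHf qf rf) (IHg qg rg)) => t _.
  by split=> /andP.
- move=> f IHf g IHg /andP[qf qg] /andP[rf rg].
  apply: decided_iff (decided_or _ _ (IHf qf rf) (IHg qg rg)) => t _.
  by split=> /orP.
- move=> f IHf g IHg /andP[qf qg] /andP[rf rg].
  apply: decided_iff (decided_or _ _ (decided_not _ (IHf qf rf)) (IHg qg rg)).
  move=> t _; split; first by case=> [/negP|]H; apply/implyP => // Hf; rewrite Hf in H.
  by case: (boolP (ord.qf_eval _ f)) => Hf /implyP H; [right; apply: H|left].
- move=> f IHf qf rf.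
  by apply: decided_iff (decided_not _ (IHf qf rf)) => t _; split=> /negP.
Qed.

(** This is o-minimality of the real field, with parameters [e]: inverses are removed first, then
    quantifiers, which leaves the quantifier-free case. *)
Lemma formula_decided (e : seq R) (i : nat) (f : ord.formula R) :
  decided_at_infinity (fun t => ord.holds (set_nth 0 e i t) f).
Proof.
have rf := ord.to_rform_rformula f.
have /andP[qg rg] := ord.quantifier_elim_wf (@qe_rcf.wf_QE_wproj R) rf.
apply: decided_iff (qf_formula_decided e i _ qg rg) => t _.
rewrite -ord.to_rformP.
by split=> /(ord.quantifier_elim_rformP (@qe_rcf.wf_QE_wproj R)
  (@qe_rcf.valid_QE_wproj R) _ rf).
Qed.

Lemma holds_fold_exists (f : ord.formula R) (I : seq nat) (e : seq R) :
  ord.holds e (foldr ord.Exists f I) <->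
  exists2 e' : seq R, (forall j, j \notin I -> e'`_j = e`_j) & ord.holds e' f.
Proof.
elim: I e => [|i I IH] e /=.
  split=> [fe|[e' ee' fe']]; first by exists e.
  by apply: ord.eq_holds fe' => j; apply: ee'.
split=> [[x] /IH[e' ee' fe']|[e' ee' fe']].
  exists e' => // j; rewrite inE negb_or => /andP[/negPf ne_ji /ee' ->].
  by rewrite nth_set_nth /= ne_ji.
exists e'`_i; apply/IH; exists e' => // j j_I.
rewrite nth_set_nth /=; case: (eqVneq j i) => [-> //|ne_ji].
by apply: ee'; rewrite inE negb_or ne_ji.
Qed.

(* Variables with index at least [k] denote [0], as for points of R^k. *)
Fixpoint term_of_poly (k : nat) (p : poly) : GRing.term R :=
  match p with
  | PConst c => GRing.Const c
  | PVar i => if (i < k)%N then GRing.Var _ i else GRing.Const (0 : R)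
  | PAdd p q => GRing.Add (term_of_poly k p) (term_of_poly k q)
  | PMul p q => GRing.Mul (term_of_poly k p) (term_of_poly k q)
  end.

Fixpoint formula_of_saf (k : nat) (f : saf) : ord.formula R :=
  match f with
  | FPos p => ord.Lt (GRing.Const (0 : R)) (term_of_poly k p)
  | FZero p => ord.Equal (term_of_poly k p) (GRing.Const (0 : R))
  | FNot g => ord.Not (formula_of_saf k g)
  | FAnd g h => ord.And (formula_of_saf k g) (formula_of_saf k h)
  | FOr g h => ord.Or (formula_of_saf k g) (formula_of_saf k h)
  end.

Definition pt_of_env (k : nat) (e : seq R) : pt :=
  fun i => if (i < k)%N then e`_i else 0.

Lemma eval_term_of_poly k e p :
  GRing.eval e (term_of_poly k p) = peval p (pt_of_env k e).
Proof.
elim: p => //= [i|p -> q ->|p -> q ->] //.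
by rewrite /pt_of_env; case: ifP.
Qed.

Lemma holds_formula_of_saf k e f :
  ord.holds e (formula_of_saf k f) <-> holds f (pt_of_env k e).
Proof.
elim: f => /= [p|p|f IHf|f IHf g IHg|f IHf g IHg]; try tauto;
  rewrite eval_term_of_poly //.
by split=> [/RltP|H]; [|apply/RltP].
Qed.

(** The parameter [t] occupies coordinate [m], the first one that vanishes on R^m. The variables
    below [m] are bound, so [m] is the only free variable of the formula. *)
Lemma exists_saf_decided (m : nat) (f g : saf) :
  decided_at_infinity (fun t => exists x, in_Rm m x /\ holds f x /\
    holds g (fun i => if i == m then t else x i)).
Proof.
pose h := ord.And (formula_of_saf m f) (formula_of_saf m.+1 g).
apply: decided_iff (formula_decided [::] m (foldr ord.Exists h (iota 0 m))).
move=> t _; rewrite holds_fold_exists.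
have ptSE e : pt_of_env m.+1 e
    = (fun i => if i == m then e`_m else pt_of_env m e i).
  apply: functional_extensionality => i; rewrite /pt_of_env ltnS leq_eqVlt.
  by case: eqP => // ->.
split=> [[e Ee /=]|[x [mx [fx gx]]]].
  have -> : t = e`_m.
    by rewrite Ee ?nth_set_nth /= ?eqxx // mem_iota ltnn andbF.
  rewrite !holds_formula_of_saf ptSE => -[fe ge].
  exists (pt_of_env m e); split=> // i /ssrnat.leP le_mi.
  by rewrite /pt_of_env ltnNge le_mi.
have nthE i : (i < m)%N -> (rcons (mkseq x m) t)`_i = x i.
  by move=> lt_im; rewrite nth_rcons size_mkseq lt_im nth_mkseq.
have ptE : pt_of_env m (rcons (mkseq x m) t) = x.
  apply: functional_extensionality => i; rewrite /pt_of_env.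
  by case: ltnP => [/nthE //|/ssrnat.leP/mx].
have nthm : (rcons (mkseq x m) t)`_m = t.
  by rewrite nth_rcons size_mkseq ltnn eqxx.
exists (rcons (mkseq x m) t).
  move=> i; rewrite mem_iota /= add0n -leqNgt nth_set_nth /= => le_mi.
  have [->//|ne_im] := eqVneq i m.
  by rewrite nth_nil nth_default // size_rcons size_mkseq ltn_neqAle eq_sym ne_im.
by rewrite /= !holds_formula_of_saf ptSE ptE nthm.
Qed.

End Definable.

(** * The Euclidean norm and distance on R^m *)

Definition scal (c : R) (x : pt) : pt := fun i => c * x i.

Lemma sumsq_ge0 m x : 0 <= sumsq m x.
Proof.
induction m as [|m IH]; simpl; [lra|].
pose proof (Rle_0_sqr (x m)); unfold Rsqr in *; lra.
Qed.

Lemma sumsq_ext m x y : (forall i, x i = y i) -> sumsq m x = sumsq m y.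
Proof. intros H; induction m as [|m IH]; simpl; [reflexivity | now rewrite IH H]. Qed.

Lemma sumsq_scal m c x : sumsq m (scal c x) = c * c * sumsq m x.
Proof. induction m as [|m IH]; simpl; [ring | rewrite IH; unfold scal; ring]. Qed.

Lemma norm_ge0 m x : 0 <= norm m x.
Proof. apply sqrt_pos. Qed.

Lemma norm_mul_norm m x : norm m x * norm m x = sumsq m x.
Proof. apply sqrt_sqrt, sumsq_ge0. Qed.

Lemma norm_ext m x y : (forall i, x i = y i) -> norm m x = norm m y.
Proof. intros H; unfold norm; now rewrite (sumsq_ext m x y H). Qed.

Lemma norm_S m x : norm (S m) x = sqrt (norm m x * norm m x + x m * x m).
Proof. now rewrite norm_mul_norm. Qed.

Lemma norm_scal m c x : norm m (scal c x) = Rabs c * norm m x.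
Proof.
unfold norm; rewrite sumsq_scal sqrt_mult_alt; [|apply Rle_0_sqr].
f_equal; apply sqrt_Rsqr_abs.
Qed.

(** The triangle inequality in the plane, which drives the induction on dimension in [norm_add]:
    [a], [b] stand for norms of truncated vectors and [p], [q] for last coordinates. *)
Lemma sqrt_minkowski a b p q : 0 <= a -> 0 <= b ->
  sqrt ((a + b) * (a + b) + (p + q) * (p + q))
  <= sqrt (a * a + p * p) + sqrt (b * b + q * q).
Proof.
intros Ha Hb.
set (u := sqrt (a * a + p * p)); set (v := sqrt (b * b + q * q)).
assert (Hu : u * u = a * a + p * p) by (apply sqrt_sqrt; nra).
assert (Hv : v * v = b * b + q * q) by (apply sqrt_sqrt; nra).
assert (Hu0 : 0 <= u) by apply sqrt_pos.
assert (Hv0 : 0 <= v) by apply sqrt_pos.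
(* Cauchy-Schwarz, from (a^2 + p^2)(b^2 + q^2) = (ab + pq)^2 + (aq - bp)^2. *)
assert (Hcs : a * b + p * q <= u * v).
{ apply Rsqr_incr_0_var; [unfold Rsqr | now apply Rmult_le_pos].
  replace (u * v * (u * v)) with ((u * u) * (v * v)) by ring.
  rewrite Hu Hv; pose proof (Rle_0_sqr (a * q - b * p)); unfold Rsqr in *; nra. }
apply Rsqr_incr_0_var; [|lra].
rewrite Rsqr_sqrt; [unfold Rsqr; nra|].
apply Rplus_le_le_0_compat; apply Rle_0_sqr.
Qed.

Lemma norm_add m x y : norm m (fun i => x i + y i) <= norm m x + norm m y.
Proof.
induction m as [|m IH].
{ unfold norm; simpl; rewrite sqrt_0; lra. }
rewrite !norm_S.
eapply Rle_trans; [|apply sqrt_minkowski; apply norm_ge0].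
apply sqrt_le_1_alt; pose proof (norm_ge0 m (fun i => x i + y i)).
pose proof (norm_ge0 m x); pose proof (norm_ge0 m y); nra.
Qed.

Lemma dist_ge0 m x y : 0 <= dist m x y.
Proof. apply norm_ge0. Qed.

Lemma dist_sym m x y : dist m x y = dist m y x.
Proof.
unfold dist; rewrite (norm_ext m _ (scal (-1) (fun i => y i - x i))).
  by rewrite norm_scal Rabs_Ropp Rabs_R1 Rmult_1_l.
intros i; unfold scal; ring.
Qed.

Lemma dist_triangle m x y z : dist m x z <= dist m x y + dist m y z.
Proof.
unfold dist; rewrite (norm_ext m _ (fun i => (x i - y i) + (y i - z i))).
  apply norm_add.
intros i; ring.
Qed.

Lemma dist_scal m c x y : dist m (scal c x) (scal c y) = Rabs c * dist m x y.
Proof.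
unfold dist; rewrite -norm_scal; apply norm_ext; intros i; unfold scal; ring.
Qed.

Lemma norm_le_add_dist m x y : norm m x <= norm m y + dist m x y.
Proof.
unfold dist; rewrite (norm_ext m x (fun i => y i + (x i - y i))).
  apply norm_add.
intros i; ring.
Qed.

Lemma dist_le_norm m x y : dist m x y <= norm m x + norm m y.
Proof.
unfold dist; rewrite (norm_ext m _ (fun i => x i + scal (-1) y i)).
  eapply Rle_trans; [apply norm_add|].
  rewrite norm_scal Rabs_Ropp Rabs_R1; lra.
intros i; unfold scal; ring.
Qed.

Lemma norm0_eq0 m x : in_Rm m x -> norm m x = 0 -> forall i, x i = 0.
Proof.
intros Hx Hn.
assert (Hs : sumsq m x = 0) by (rewrite -norm_mul_norm Hn; ring).
assert (Hk : forall i, (i < m)%coq_nat -> x i = 0).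
{ clear Hx Hn; revert Hs; induction m as [|m IH]; simpl; intros Hs i Hi; [lia|].
  pose proof (sumsq_ge0 m x); pose proof (Rle_0_sqr (x m)); unfold Rsqr in *.
  destruct (Nat.eq_dec i m) as [->|Hne]; [|apply IH; [lra|lia]].
  apply Rsqr_0_uniq; unfold Rsqr; lra. }
intros i; destruct (Nat.le_gt_cases m i) as [Hi|Hi]; auto.
Qed.

Lemma dist0_eq m x y : in_Rm m x -> in_Rm m y -> dist m x y = 0 -> x = y.
Proof.
intros Hx Hy Hd; apply functional_extensionality; intros i.
enough (x i - y i = 0) by lra.
apply (norm0_eq0 m (fun i => x i - y i)); auto.
intros j Hj; rewrite Hx ?Hy //; ring.
Qed.

Lemma nat_large (M : R) :
  exists N, forall k, (N <= k)%coq_nat -> M < INR k /\ 0 < INR k.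
Proof.
destruct (INR_unbounded (Rmax M 0)) as [N HN]; exists N; intros k Hk.
pose proof (le_INR _ _ Hk); pose proof (Rmax_l M 0); pose proof (Rmax_r M 0); lra.
Qed.

(** The open balls of integer radius about the origin cover [K], and a finite subcover has a largest
    radius. *)
Lemma compact_bounded m K : compact_in_Rm m K ->
  exists r, forall x, K x -> norm m x <= r.
Proof.
intros [HKm HK].
destruct (HK nat (fun i x => in_Rm m x /\ norm m x < INR i)) as [l Hl].
- intros i x [Hx Hn]; split; [exact Hx|].
  exists (INR i - norm m x); split; [lra|]; intros y Hy Hd; split; [exact Hy|].
  pose proof (norm_le_add_dist m y x); rewrite dist_sym in Hd; lra.
- intros x Hx; destruct (nat_large (norm m x)) as [N HN].
  exists N; split; [auto | apply HN; lia].
- exists (INR (List.list_max l)); intros x Hx.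
  destruct (Hl x Hx) as [i [Hi [_ Hn]]].
  enough (INR i <= INR (List.list_max l)) by lra.
  apply le_INR; pose proof (List.list_max_le l (List.list_max l)) as [H _].
  specialize (H (le_n _)); rewrite -> List.Forall_forall in H; auto.
Qed.

(** * Independence of the sequence of radii *)

(** The condition that [x / t] be within [eps] of [v] is multiplied by [t], so that squaring makes
    it polynomial in [x] and [t]. *)
Definition near_slice m (A : pt -> Prop) (v : pt) (eps t : R) : Prop :=
  exists x, A x /\ norm m x = t /\ dist m x (scal t v) < eps * t.

Fixpoint poly_sumsq (m : nat) (q : nat -> poly) : poly :=
  match m with
  | O => PConst 0
  | S k => PAdd (poly_sumsq k q) (PMul (q k) (q k))
  end.

Lemma peval_sumsq m q z :
  peval (poly_sumsq m q) z = sumsq m (fun i => peval (q i) z).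
Proof. induction m as [|m IH]; simpl; [reflexivity | now rewrite IH]. Qed.

Lemma sumsq_ext_lt m x y :
  (forall i, (i < m)%coq_nat -> x i = y i) -> sumsq m x = sumsq m y.
Proof.
intros H; induction m as [|m IH]; simpl; [reflexivity|].
rewrite IH ?H //; intros; apply H; lia.
Qed.

Lemma near_slice_decided m A v eps : semialgebraic m A -> 0 < eps ->
  decided_at_infinity (near_slice m A v eps).
Proof.
intros [f Hf] Heps.
set (T := PVar m).
(* [q1 = 0] says |x|^2 = t^2, and [q2 > 0] says |x - t v|^2 < eps^2 t^2. The number [eps] and the
   coordinates of [v] enter as real constants. *)
set (q1 := PAdd (poly_sumsq m PVar) (PMul (PConst (-1)) (PMul T T))).
set (q2 := PAdd (PMul (PConst (eps * eps)) (PMul T T)) (PMul (PConst (-1))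
  (poly_sumsq m (fun i => PAdd (PVar i) (PMul (PConst (- v i)) T))))).
apply: decided_iff (exists_saf_decided m f (FAnd (FZero q1) (FPos q2))) => t Ht.
assert (Hg : forall x,
  holds (FAnd (FZero q1) (FPos q2)) (fun i => if i == m then t else x i) <->
  norm m x = t /\ dist m x (scal t v) < eps * t).
{ intros x; simpl; rewrite !peval_sumsq eqxx /=.
  rewrite (sumsq_ext_lt m _ x); last first.
  { intros i Hi; case: (i =P m) => [Ei|//]; lia. }
  rewrite [sumsq m (fun i => _ + _)]
    (sumsq_ext_lt m _ (fun i => x i - scal t v i)); last first.
  { intros i Hi; unfold scal; case: (i =P m) => [Ei|_]; [lia|rewrite eqxx; ring]. }
  rewrite -!norm_mul_norm -/(dist m x (scal t v)).
  pose proof (norm_ge0 m x); pose proof (dist_ge0 m x (scal t v)).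
  assert (0 < eps * t) by (apply Rmult_lt_0_compat; lra).
  split; intros [E1 E2]; split; nra. }
split.
- intros [x [Hx [Hfx Hgx]]]; exists x; split; [now apply Hf | now apply Hg].
- intros [x [Hx Hnx]]; exists x; apply Hf in Hx; destruct Hx as [Hm Hfx].
  split; [exact Hm | split; [exact Hfx | now apply Hg]].
Qed.

Definition tends_to_infinity (t : nat -> R) : Prop :=
  forall M, exists J, forall j, (J <= j)%coq_nat -> t j > M.

Lemma dist_scal_inv m t x v : 0 < t ->
  t * dist m (scal (/ t) x) v = dist m x (scal t v).
Proof.
intros Ht; rewrite -{1}(Rabs_pos_eq t); [|lra]; rewrite -dist_scal.
unfold dist; apply norm_ext; intros i; unfold scal; field; lra.
Qed.

Lemma dist_scal_inv_lt m t x v eps : 0 < t ->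
  dist m (scal (/ t) x) v < eps <-> dist m x (scal t v) < eps * t.
Proof. intros Ht; rewrite -dist_scal_inv //; split; intros H; nra. Qed.

Lemma scaled_slice_near m A v eps t y : 0 < t ->
  scaled_slice m A t y -> dist m y v < eps -> near_slice m A v eps t.
Proof.
intros Ht [x [Hx [Hn Hy]]] Hd; exists x; split; [exact Hx|]; split; [exact Hn|].
apply dist_scal_inv_lt; [exact Ht|].
replace (scal (/ t) x) with y; [exact Hd|].
apply functional_extensionality; exact Hy.
Qed.

Lemma near_scaled_slice m A v eps t : 0 < t -> near_slice m A v eps t ->
  exists y, scaled_slice m A t y /\ dist m y v < eps.
Proof.
intros Ht [x [Hx [Hn Hd]]]; exists (scal (/ t) x); split.
- exists x; split; [exact Hx|]; split; [exact Hn | reflexivity].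
- now apply dist_scal_inv_lt.
Qed.

Lemma decided_frequently (P : R -> Prop) : decided_at_infinity P ->
  (forall M, exists t, M < t /\ P t) -> exists M, forall t, M < t -> P t.
Proof.
intros [M [H|H]] Hf; [now exists M|].
destruct (Hf M) as [t [Ht HP]]; now destruct (H t Ht).
Qed.

Section SliceLimit.
Variables (m : nat) (A D : pt -> Prop) (t : nat -> R).
Hypotheses (sA : semialgebraic m A) (t_gt0 : forall j, t j > 0)
  (t_infty : tends_to_infinity t)
  (limD : hausdorff_limit m (fun j => scaled_slice m A (t j)) D).

(** The radii [t j] give the property at arbitrarily large values, and decidedness extends it to all
    large ones. *)
Lemma slice_limit_near v eps : D v -> 0 < eps ->
  exists M, forall s, M < s -> near_slice m A v eps s.
Proof.
intros Dv Heps; apply decided_frequently; [now apply near_slice_decided|].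
intros M; destruct (limD eps Heps) as [J HJ]; destruct (t_infty M) as [J' HJ'].
set (j := Nat.max J J'); exists (t j); split; [apply HJ'; lia|].
destruct (HJ j ltac:(lia)) as [_ H]; destruct (H v Dv) as [x [Hx Hd]].
exact (scaled_slice_near _ _ _ _ _ _ (t_gt0 j) Hx Hd).
Qed.

(** By decidedness the property reaches some [t j] whose slice is already [eps]-close to [D]; the
    two errors add up. *)
Lemma near_frequently_approx v eps : 0 < eps ->
  (forall M, exists s, M < s /\ near_slice m A v eps s) ->
  exists y, D y /\ dist m v y < eps + eps.
Proof.
intros Heps Hf.
destruct (decided_frequently _ (near_slice_decided m A v eps sA Heps) Hf)
  as [M HM].
destruct (limD eps Heps) as [J HJ]; destruct (t_infty M) as [J' HJ'].
set (j := Nat.max J J'); destruct (HJ j ltac:(lia)) as [H _].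
destruct (near_scaled_slice _ _ _ _ _ (t_gt0 j) (HM (t j) (HJ' j ltac:(lia))))
  as [y [Hy Hd]].
destruct (H y Hy) as [z [Hz Hd']]; exists z; split; [exact Hz|].
pose proof (dist_triangle m v y z) as Htri; rewrite (dist_sym m v y) in Htri; lra.
Qed.

Lemma near_frequently_slice_limit v : closed_in_Rm m D -> in_Rm m v ->
  (forall eps M, 0 < eps -> exists s, M < s /\ near_slice m A v eps s) -> D v.
Proof.
intros [_ Hcl] Hv Hf; apply Hcl; [exact Hv|]; intros eps Heps.
destruct (near_frequently_approx v (eps / 2) ltac:(lra)) as [y [Hy Hd]].
- intros M; apply Hf; lra.
- exists y; split; [exact Hy | lra].
Qed.

(** For [v = 0] and [eps = 2] nearness reads |x| < 2t, which every point of norm [t > 0]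
    satisfies. *)
Lemma slice_limit_inhabited : unbounded m A -> exists v, D v.
Proof.
intros HA; destruct (near_frequently_approx (fun _ => 0) 2) as [y [Hy _]];
  [lra | | now exists y].
intros M; destruct (HA (Rmax M 0)) as [x [Hx Hn]].
pose proof (Rmax_l M 0); pose proof (Rmax_r M 0).
exists (norm m x); split; [lra|]; exists x; split; [exact Hx|].
split; [reflexivity|].
eapply Rle_lt_trans; [apply dist_le_norm|].
rewrite norm_scal; replace (norm m (fun _ => 0)) with 0.
  lra.
rewrite (norm_ext m _ (scal 0 x)); [rewrite norm_scal Rabs_R0; ring|].
intros i; unfold scal; ring.
Qed.

End SliceLimit.

(** * Asymptotic cones *)

(* Every element of [C] is a limit along all the dilations [1/k], while a limit
   along a subsequence of them suffices for belonging to [C]. *)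
Definition asymptotic_cone m (X C : pt -> Prop) : Prop :=
  [/\ forall v, C v -> in_Rm m v,
      forall v eps, C v -> 0 < eps -> exists N, forall k, (N <= k)%coq_nat ->
        exists x, X x /\ dist m (scal (/ INR k) x) v < eps &
      forall w, in_Rm m w ->
        (forall eps N, 0 < eps -> exists k x, (N <= k)%coq_nat /\ X x /\
          dist m (scal (/ INR k) x) w < eps) -> C w].

(** A vector [s w] with [s > 0] and [w] in [D] is approached at scale [k] by points of norm [s k].
    Conversely, points close to [k w] have norm close to [k |w|], so normalizing them gives
    directions close to [w / |w|]. *)
Lemma tangent_cone_asymptotic m A K C :
  semialgebraic m A -> unbounded m A -> compact_in_Rm m K ->
  tangent_cone_at_infinity m A C ->
  asymptotic_cone m (fun x => A x /\ ~ K x) C.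
Proof.
intros sA uA cK [t [D [Ht [Htinf [HDs [HDc [HDl HC]]]]]]].
destruct (compact_bounded m K cK) as [r Hr].
split.
- intros v Hv; apply HC in Hv; destruct Hv as [s [w [_ [Dw Hvw]]]].
  intros i Hi; rewrite Hvw; destruct (HDs w Dw) as [Hw _]; rewrite Hw //; ring.
- intros v eps Hv Heps; apply HC in Hv; destruct Hv as [s [w [Hs [Dw Hvw]]]].
  destruct Hs as [Hs|<-].
  (* The slice has radius [s * INR k], so an error [eps / s] relative to that radius is an error
     [eps] relative to [INR k]. *)
  + assert (Heps' : 0 < eps / s) by (apply Rdiv_lt_0_compat; lra).
    destruct (slice_limit_near m A D t sA Ht Htinf HDl w (eps / s) Dw Heps')
      as [M HM].
    destruct (nat_large (Rmax M r / s)) as [N HN]; exists N; intros k Hk.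
    destruct (HN k Hk) as [Hk1 Hk0].
    assert (Hsk : Rmax M r < s * INR k).
    { apply (Rmult_lt_compat_l s) in Hk1; [|lra].
      replace (s * (Rmax M r / s)) with (Rmax M r) in Hk1 by (field; lra); lra. }
    pose proof (Rmax_l M r); pose proof (Rmax_r M r).
    destruct (HM (s * INR k) ltac:(lra)) as [x [Ax [Hn Hd]]].
    exists x; split.
    * split; [exact Ax|]; intros Kx; specialize (Hr x Kx); lra.
    * apply dist_scal_inv_lt; [exact Hk0|].
      replace (eps / s * (s * INR k)) with (eps * INR k) in Hd by (field; lra).
      replace (scal (INR k) v) with (scal (s * INR k) w); [exact Hd|].
      apply functional_extensionality; intros i; unfold scal; rewrite Hvw; ring.
  (* The apex is the limit of the dilations of a single point [a] of [A] outside [K]. *)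
  + destruct (uA r) as [a [Aa Ha]].
    destruct (nat_large (norm m a / eps)) as [N HN]; exists N; intros k Hk.
    destruct (HN k Hk) as [Hk1 Hk0]; exists a; split.
    * split; [exact Aa|]; intros Ka; specialize (Hr a Ka); lra.
    * apply dist_scal_inv_lt; [exact Hk0|].
      apply (Rmult_lt_compat_l eps) in Hk1; [|lra].
      replace (eps * (norm m a / eps)) with (norm m a) in Hk1 by (field; lra).
      unfold dist; rewrite (norm_ext m _ a); [exact Hk1|].
      intros i; unfold scal; rewrite Hvw; ring.
- intros w Hw Hf; apply HC.
  destruct (Rle_lt_or_eq_dec 0 _ (norm_ge0 m w)) as [Hs|Hs].
  (* The apex is [0] times any direction, so it suffices that [D] is nonempty. *)
  2:{ destruct (slice_limit_inhabited m A D t sA Ht Htinf HDl uA) as [v Dv].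
      exists 0, v; split; [lra|]; split; [exact Dv|]; intros i.
      rewrite (norm0_eq0 m w) //; ring. }
  set (s := norm m w) in *.
  exists s, (scal (/ s) w); split; [lra|]; split.
  2:{ intros i; unfold scal; field; lra. }
  apply (near_frequently_slice_limit m A D t); try assumption.
  { intros i Hi; unfold scal; rewrite Hw //; ring. }
  intros eps M Heps.
  (* For |y - k w| < d k, the bound [d <= s / 2] gives |y| >= k s / 2, which is large; and
     [4 * d <= eps * s] makes the total error, below 2 d k, less than eps |y|. *)
  set (d := Rmin (s / 2) (eps * s / 4)).
  assert (Hd : 0 < d /\ d <= s / 2 /\ 4 * d <= eps * s).
  { assert (0 < eps * s) by (apply Rmult_lt_0_compat; lra).
    pose proof (Rmin_l (s / 2) (eps * s / 4)).
    pose proof (Rmin_r (s / 2) (eps * s / 4)).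
    split; [apply Rmin_pos; lra | unfold d; lra]. }
  destruct (nat_large (2 * M / s)) as [N HN].
  destruct (Hf d N (proj1 Hd)) as [k [y [Hk [[Ay _] Hyw]]]].
  destruct (HN k Hk) as [HkM Hk0].
  apply dist_scal_inv_lt in Hyw; [|exact Hk0].
  assert (HkM' : M < INR k * s / 2).
  { apply (Rmult_lt_compat_l (s / 2)) in HkM; [|lra].
    replace (s / 2 * (2 * M / s)) with M in HkM by (field; lra); lra. }
  assert (Hkw : norm m (scal (INR k) w) = INR k * s).
  { rewrite norm_scal Rabs_pos_eq; [reflexivity | lra]. }
  pose proof (norm_le_add_dist m y (scal (INR k) w)) as H1.
  pose proof (norm_le_add_dist m (scal (INR k) w) y) as H2.
  rewrite dist_sym in H2; rewrite -> Hkw in *.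
  assert (Hyk : INR k * s / 2 <= norm m y) by nra.
  exists (norm m y); split; [lra|]; exists y; split; [exact Ay|].
  split; [reflexivity|].
  eapply Rle_lt_trans; [apply (dist_triangle m _ (scal (INR k) w))|].
  assert (H3 : dist m (scal (INR k) w) (scal (norm m y) (scal (/ s) w))
    = Rabs (INR k * s - norm m y)).
  { unfold dist; rewrite (norm_ext m _ (scal ((INR k * s - norm m y) * / s) w)).
    - rewrite norm_scal Rabs_mult (Rabs_pos_eq (/ s)); last first.
      { left; apply Rinv_0_lt_compat; lra. }
      fold s; field; lra.
    - intros i; unfold scal; field; lra. }
  rewrite H3.
  assert (Rabs (INR k * s - norm m y) < d * INR k) by (apply Rabs_def1; lra).
  assert (4 * d * INR k <= eps * s * INR k) by (apply Rmult_le_compat_r; lra).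
  assert (eps * (INR k * s / 2) <= eps * norm m y) by (apply Rmult_le_compat_l; lra).
  lra.
Qed.

(** * Limits along an ultrafilter *)

(* The first clause, containing the tails, makes [U] non-principal. *)
Definition is_ultrafilter (U : (nat -> Prop) -> Prop) : Prop :=
  [/\ forall P N, (forall k, (N <= k)%coq_nat -> P k) -> U P,
      forall P Q, U P -> U Q -> U (fun k => P k /\ Q k),
      forall P Q : nat -> Prop, (forall k, P k -> Q k) -> U P -> U Q,
      forall P, U P -> exists k, P k &
      forall P, U P \/ U (fun k => ~ P k)].

Lemma nonprincipal_ultrafilter : exists U, is_ultrafilter U.
Proof.
have [U [Uultra subU]] := ultraFilterLemma eventually_filter.
exists U; split.
- by move=> P N NP; apply: subU; exists N => // k /ssrnat.leP /NP.
- by move=> P Q UP UQ; apply: filterI.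
- by move=> P Q PQ; apply: filterS.
- by move=> P /filter_ex.
- by move=> P; apply: in_ultra_setVsetC.
Qed.

(** The limit is the supremum of the [r] that lie below [u k] for [U]-almost all [k]. *)
Lemma ultralimit_real U (u : nat -> R) (c : R) : is_ultrafilter U ->
  U (fun k => Rabs (u k) <= c) ->
  exists l, forall eps, 0 < eps -> U (fun k => Rabs (u k - l) < eps).
Proof.
intros [_ UI US UE UC] Hc.
set (E := fun r => U (fun k => r < u k)).
assert (Hb : bound E).
{ exists c; intros r Hr; destruct (UE _ (UI _ _ Hc Hr)) as [k [H1 H2]].
  pose proof (Rle_abs (u k)); lra. }
assert (He : exists r, E r).
{ exists (- c - 1); apply: US Hc => k Hk.
  pose proof (Rle_abs (- u k)) as H; rewrite Rabs_Ropp in H; lra. }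
destruct (completeness E Hb He) as [l [Hub Hlub]].
exists l; intros eps Heps.
assert (Hlow : U (fun k => l - eps < u k)).
{ apply NNPP; intros Hn.
  enough (l <= l - eps) by lra.
  apply Hlub; intros r Hr; apply Rnot_lt_le; intros Hlt; apply Hn.
  apply: US Hr => k Hk; lra. }
(* The complement gives only a weak inequality; halving [eps] makes the final bound strict. *)
destruct (UC (fun k => l + eps / 2 < u k)) as [Hup|Hup].
{ specialize (Hub _ Hup); lra. }
apply: US (UI _ _ Hlow Hup) => k [H1 H2]; apply Rabs_def1; lra.
Qed.

(** Induction on dimension: the last coordinate has a real ultralimit, and a norm is at most the
    norm of the truncated vector plus the last coordinate in absolute value. *)
Lemma ultralimit_pt U m (u : nat -> pt) (c : R) : is_ultrafilter U ->
  U (fun k => norm m (u k) <= c) ->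
  exists l, in_Rm m l /\
    forall eps, 0 < eps -> U (fun k => dist m (u k) l < eps).
Proof.
intros HU; pose proof HU as [UN UI US _ _].
induction m as [|m IH]; intros Hc.
{ exists (fun _ => 0); split; [intros i _; reflexivity|].
  intros eps Heps; apply (UN _ 0%nat); intros k _.
  unfold dist, norm; simpl; rewrite sqrt_0; exact Heps. }
assert (Hn : forall x, norm m x <= norm (S m) x /\ Rabs (x m) <= norm (S m) x).
{ intros x; split.
  - apply sqrt_le_1_alt; simpl; pose proof (Rle_0_sqr (x m)); unfold Rsqr in *; lra.
  - rewrite -sqrt_Rsqr_abs; apply sqrt_le_1_alt; simpl; unfold Rsqr.
    pose proof (sumsq_ge0 m x); lra. }
destruct IH as [l [Hl Hlim]].
{ apply: US Hc => k Hk; pose proof (proj1 (Hn (u k))); lra. }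
destruct (ultralimit_real U (fun k => u k m) c HU) as [a Ha].
{ apply: US Hc => k Hk; pose proof (proj2 (Hn (u k))); lra. }
exists (fun i => if i == m then a else l i); split.
{ intros i Hi; case: (i =P m) => [Ei|_]; [lia|]; apply Hl; lia. }
intros eps Heps; assert (Heps2 : 0 < eps / 2) by lra.
apply: US (UI _ _ (Hlim _ Heps2) (Ha _ Heps2)) => k [H1 H2].
assert (Hd : norm m (fun i => u k i - (if i == m then a else l i))
  = dist m (u k) l).
{ unfold dist, norm; f_equal; apply sumsq_ext_lt; intros i Hi.
  case: (i =P m) => [Ei|_]; [lia | reflexivity]. }
unfold dist at 1; rewrite norm_S Hd eqxx.
set (b := u k m - a) in *; set (d := dist m (u k) l) in *.
assert (Hd0 : 0 <= d) by apply dist_ge0.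
assert (Hb : b * b = Rabs b * Rabs b).
{ rewrite -Rabs_mult Rabs_pos_eq; [reflexivity | apply Rle_0_sqr]. }
apply Rle_lt_trans with (d + Rabs b); [|lra].
pose proof (Rabs_pos b).
rewrite -(sqrt_Rsqr (d + Rabs b)); [apply sqrt_le_1_alt; unfold Rsqr; nra | lra].
Qed.

(** * Limits of dilated sequences and their images under Lipschitz maps *)

(** Membership in [X] is asked only on a set of [U], so the sequence may take arbitrary values
    elsewhere. *)
Definition dilation_limit U m (X : pt -> Prop) (x : nat -> pt) (v : pt) : Prop :=
  U (fun k => X (x k)) /\
  forall eps, 0 < eps -> U (fun k => dist m (scal (/ INR k) (x k)) v < eps).

(** Dilating source and target by the same factor preserves the Lipschitz constant. As the two
    sequences are arbitrary, the case [v = v'] shows that the limit of the images does not depend on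
    the sequence. *)
Lemma dilation_limit_lipschitz U m n X Y f L x x' v v' w w' :
  is_ultrafilter U -> 0 < L ->
  (forall a b, X a -> X b -> dist n (f a) (f b) <= L * dist m a b) ->
  dilation_limit U m X x v -> dilation_limit U m X x' v' ->
  dilation_limit U n Y (fun k => f (x k)) w ->
  dilation_limit U n Y (fun k => f (x' k)) w' ->
  dist n w w' <= L * dist m v v'.
Proof.
intros [UN UI _ UE _] HL Hf [Hx Hv] [Hx' Hv'] [_ Hw] [_ Hw'].
apply Rnot_lt_le; intros Hlt.
set (gap := dist n w w' - L * dist m v v').
(* Four approximations, two of them multiplied by [L], cost [(2 + 2 * L) * eps], half of [gap]. *)
set (eps := gap / (2 * (2 + 2 * L))).
assert (Heps : 0 < eps) by (apply Rdiv_lt_0_compat; unfold gap; lra).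
assert (Hgap : gap = (2 * (2 + 2 * L)) * eps) by (unfold eps; field; lra).
pose proof (UN (fun k => 1 <= INR k) 1%nat (fun k Hk => le_INR _ _ Hk)) as H1.
destruct (UE _ (UI _ _ (UI _ _ (UI _ _ Hx Hx') (UI _ _ (Hv _ Heps) (Hv' _ Heps)))
  (UI _ _ (UI _ _ (Hw _ Heps) (Hw' _ Heps)) H1)))
  as [k [[[Xx Xx'] [Dv Dv']] [[Dw Dw'] Hk]]].
set (c := / INR k) in *.
assert (Hc : 0 < c) by (apply Rinv_0_lt_compat; lra).
assert (Hd : dist n (scal c (f (x k))) (scal c (f (x' k)))
  <= L * dist m (scal c (x k)) (scal c (x' k))).
{ rewrite !dist_scal (Rabs_pos_eq c); [|lra].
  specialize (Hf _ _ Xx Xx'); nra. }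
pose proof (dist_triangle n w (scal c (f (x k))) w') as T1.
pose proof (dist_triangle n (scal c (f (x k))) (scal c (f (x' k))) w') as T2.
pose proof (dist_triangle m (scal c (x k)) v (scal c (x' k))) as T3.
pose proof (dist_triangle m v v' (scal c (x' k))) as T4.
rewrite (dist_sym n w (scal c _)) in T1; rewrite (dist_sym m v' (scal c _)) in T4.
assert (T5 : L * dist m (scal c (x k)) (scal c (x' k))
  <= L * (dist m v v' + 2 * eps)) by (apply Rmult_le_compat_l; lra).
assert (0 < L * eps) by (apply Rmult_lt_0_compat; lra).
unfold gap in Hgap; lra.
Qed.

(** A diagonal choice: [x k] meets at once every tolerance [/ INR (S i)] with [i <= k] that is
    attainable at index [k]. *)
Lemma asymptotic_cone_sequence U m X C v : is_ultrafilter U ->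
  asymptotic_cone m X C -> C v -> exists x, dilation_limit U m X x v.
Proof.
intros [UN UI US _ _] [_ Hseq _] Cv.
set (P := fun (j k : nat) x =>
  X x /\ dist m (scal (/ INR k) x) v < / INR (S j)).
assert (Hmono : forall i j k x, (i <= j)%coq_nat -> P j k x -> P i k x).
{ intros i j k x Hij [Xx Hd]; split; [exact Xx|].
  eapply Rlt_le_trans; [exact Hd|]; apply Rinv_le_contravar.
  - apply lt_0_INR; lia.
  - apply le_INR; lia. }
(* A point for the finest attainable tolerance also serves the coarser ones. *)
assert (Hbest : forall k j, exists x,
  forall i, (i <= j)%coq_nat -> (exists y, P i k y) -> P i k x).
{ intros k j; induction j as [|j [x Hx]].
  - destruct (classic (exists y, P 0%nat k y)) as [[y Hy]|Hn].
    + exists y; intros i Hi _; apply (Hmono i 0%nat); [lia | exact Hy].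
    + exists (fun _ => 0); intros i Hi Hi'.
      replace i with 0%nat in Hi' by lia; now destruct Hn.
  - destruct (classic (exists y, P (S j) k y)) as [[y Hy]|Hn].
    + exists y; intros i Hi _; apply (Hmono i (S j)); [lia | exact Hy].
    + exists x; intros i Hi Hi'; apply Hx; [|exact Hi'].
      destruct (Nat.eq_dec i (S j)) as [->|Hne]; [now destruct Hn | lia]. }
set (x := fun k => epsilon (inhabits (fun _ => 0)) (fun x =>
  forall i, (i <= k)%coq_nat -> (exists y, P i k y) -> P i k x)).
assert (Hx : forall k i, (i <= k)%coq_nat -> (exists y, P i k y) -> P i k (x k)).
{ intros k; exact (epsilon_spec (inhabits (fun _ => 0)) _ (Hbest k k)). }
assert (HP : forall i, U (fun k => P i k (x k))).
{ intros i; destruct (Hseq v (/ INR (S i)) Cv) as [N HN].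
  { apply Rinv_0_lt_compat, lt_0_INR; lia. }
  apply (UN _ (Nat.max N i)); intros k Hk; apply Hx; [lia | apply HN; lia]. }
exists x; split.
- apply: US (HP 0%nat) => k [H _]; exact H.
- intros eps Heps; destruct (nat_large (/ eps)) as [N HN].
  apply: US (HP N) => k [_ H]; eapply Rlt_trans; [exact H|].
  destruct (HN (S N) ltac:(lia)) as [H1 _].
  rewrite -(Rinv_inv eps); apply Rinv_lt_contravar; [|exact H1].
  pose proof (Rinv_0_lt_compat _ Heps); apply Rmult_lt_0_compat; lra.
Qed.

(** Comparison with the image of one fixed point [a] of [X] bounds [f (x k) / k], so an ultralimit
    exists; it lies in [C] because a set of [U] meets every tail. *)
Lemma dilation_limit_exists U m n X Y C f L x v :
  is_ultrafilter U -> 0 < L -> asymptotic_cone n Y C ->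
  (forall a, X a -> Y (f a)) ->
  (forall a b, X a -> X b -> dist n (f a) (f b) <= L * dist m a b) ->
  dilation_limit U m X x v ->
  exists w, C w /\ dilation_limit U n Y (fun k => f (x k)) w.
Proof.
intros HU HL [_ _ HC] HXY Hf [Hx Hv]; pose proof HU as [UN UI US UE _].
destruct (UE _ Hx) as [k0 Ha]; set (a := x k0) in *.
pose proof (UN (fun k => 1 <= INR k) 1%nat (fun k Hk => le_INR _ _ Hk)) as H1.
destruct (ultralimit_pt U n (fun k => scal (/ INR k) (f (x k)))
  (norm n (f a) + L * (norm m v + 1 + norm m a)) HU) as [w [Hw Hlim]].
{ apply: US (UI _ _ (UI _ _ Hx (Hv 1 Rlt_0_1)) H1) => k [[Xx Hd] Hk].
  assert (Hc0 : 0 < / INR k) by (apply Rinv_0_lt_compat; lra).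
  assert (Hc1 : / INR k <= 1).
  { rewrite -Rinv_1; apply Rinv_le_contravar; lra. }
  set (c := / INR k) in *.
  rewrite norm_scal (Rabs_pos_eq c); [|lra].
  pose proof (norm_le_add_dist n (f (x k)) (f a)) as T1.
  specialize (Hf _ _ Xx Ha).
  pose proof (dist_le_norm m (x k) a) as T2.
  pose proof (norm_le_add_dist m (scal c (x k)) v) as T3.
  rewrite norm_scal (Rabs_pos_eq c) in T3; [|lra].
  pose proof (norm_ge0 n (f a)); pose proof (norm_ge0 m a).
  assert (T4 : c * norm n (f (x k))
    <= c * norm n (f a) + L * (c * norm m (x k) + c * norm m a)).
  { replace (c * norm n (f a) + L * (c * norm m (x k) + c * norm m a))
      with (c * (norm n (f a) + L * (norm m (x k) + norm m a))) by ring.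
    apply Rmult_le_compat_l; [lra|]; nra. }
  assert (c * norm n (f a) <= norm n (f a)) by nra.
  assert (c * norm m a <= norm m a) by nra.
  assert (L * (c * norm m (x k) + c * norm m a)
    <= L * (norm m v + 1 + norm m a)) by (apply Rmult_le_compat_l; lra).
  lra. }
assert (HY : U (fun k => Y (f (x k)))) by (apply: US Hx => k; apply HXY).
exists w; split; [|now split].
apply HC; [exact Hw|]; intros eps N Heps.
destruct (UE _ (UI _ _ (UI _ _ HY (Hlim eps Heps)) (UN _ N (fun k Hk => Hk))))
  as [k [[Yk Hd] Hk]].
now exists k, (f (x k)).
Qed.

(** Only the existence of a suitable sequence is kept for each [v], which suffices since the
    estimate on limits holds for any two sequences. *)
Lemma asymptotic_cone_lift U m n X Y CX CY f L :
  is_ultrafilter U -> 0 < L -> asymptotic_cone m X CX -> asymptotic_cone n Y CY ->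
  (forall a, X a -> Y (f a)) ->
  (forall a b, X a -> X b -> dist n (f a) (f b) <= L * dist m a b) ->
  exists phi, forall v, CX v -> CY (phi v) /\ exists x,
    dilation_limit U m X x v /\ dilation_limit U n Y (fun k => f (x k)) (phi v).
Proof.
intros HU HL HX HY HXY Hf.
set (Q := fun v w => CY w /\ exists x,
  dilation_limit U m X x v /\ dilation_limit U n Y (fun k => f (x k)) w).
exists (fun v => epsilon (inhabits (fun _ => 0)) (Q v)); intros v Hv.
apply (epsilon_spec (inhabits (fun _ => 0)) (Q v)).
destruct (asymptotic_cone_sequence U m X CX v HU HX Hv) as [x Hx].
destruct (dilation_limit_exists U m n X Y CY f L x v HU HL HY HXY Hf Hx)
  as [w [Hw Hlim]].
exists w; split; [exact Hw | now exists x].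
Qed.

(** * The bi-Lipschitz homeomorphism between the cones *)

Lemma asymptotic_cone_bilip m n X Y CX CY :
  asymptotic_cone m X CX -> asymptotic_cone n Y CY ->
  bilip_homeomorphic m n X Y -> bilip_homeomorphic m n CX CY.
Proof.
intros HX HY [f [g [L [HL [HXY [HYX [Hgf [Hfg [Hf Hg]]]]]]]]].
(* One ultrafilter serves both [f] and [g], so that their limits can be compared. *)
destruct nonprincipal_ultrafilter as [U HU].
destruct (asymptotic_cone_lift U m n X Y CX CY f L HU HL HX HY HXY Hf)
  as [phi Hphi].
destruct (asymptotic_cone_lift U n m Y X CY CX g L HU HL HY HX HYX Hg)
  as [psi Hpsi].
(* A sequence [x] in [X] is also the image under [g] of the sequence [f x], so
   the Lipschitz estimate for [g] identifies the limits of both. *)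
assert (Hid : forall m' n' X' Y' C' f' g' phi' psi' v, asymptotic_cone m' X' C' ->
  (forall a b, Y' a -> Y' b -> dist m' (g' a) (g' b) <= L * dist n' a b) ->
  (forall a, X' a -> g' (f' a) = a) -> C' v -> C' (psi' (phi' v)) ->
  (exists x, dilation_limit U m' X' x v /\
    dilation_limit U n' Y' (fun k => f' (x k)) (phi' v)) ->
  (exists y, dilation_limit U n' Y' y (phi' v) /\
    dilation_limit U m' X' (fun k => g' (y k)) (psi' (phi' v))) ->
  psi' (phi' v) = v).
{ intros m' n' X' Y' C' f' g' phi' psi' v [HC _ _] Hg' Hgf' Cv Cv'
    [x [[Xx Hx] Hfx]] [y [Hy Hgy]].
  apply (dist0_eq m'); [now apply HC | now apply HC|].
  apply Rle_antisym; [|apply dist_ge0].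
  replace 0 with (L * dist n' (phi' v) (phi' v)).
  2:{ unfold dist; rewrite (norm_ext n' _ (scal 0 (fun _ => 0))).
      - rewrite norm_scal Rabs_R0; ring.
      - intros i; unfold scal; ring. }
  apply (dilation_limit_lipschitz U n' m' Y' X' g' L y (fun k => f' (x k))
    _ _ _ _ HU HL Hg' Hy Hfx Hgy).
  (* The identity [g' (f' (x k)) = x k] is available where [x k] lies in [X'], that is on a set of
     [U]. *)
  destruct HU as [_ UI US _ _]; split.
  - apply: US Xx => k Xk; now rewrite Hgf'.
  - intros eps Heps; apply: US (UI _ _ Xx (Hx eps Heps)) => k [Xk Hk].
    now rewrite Hgf'. }
exists phi, psi, L; split; [exact HL|].
split; [intros v Hv; apply Hphi, Hv|]; split; [intros w Hw; apply Hpsi, Hw|].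
split; [|split; [|split]].
- intros v Hv; destruct (Hphi v Hv) as [H1 H2]; destruct (Hpsi _ H1) as [H3 H4].
  exact (Hid m n X Y CX f g phi psi v HX Hg Hgf Hv H3 H2 H4).
- intros w Hw; destruct (Hpsi w Hw) as [H1 H2]; destruct (Hphi _ H1) as [H3 H4].
  exact (Hid n m Y X CY g f psi phi w HY Hf Hfg Hw H3 H2 H4).
- intros v v' Hv Hv'; destruct (Hphi v Hv) as [_ [x [Hx Hfx]]].
  destruct (Hphi v' Hv') as [_ [x' [Hx' Hfx']]].
  exact (dilation_limit_lipschitz U m n X Y f L x x' _ _ _ _
    HU HL Hf Hx Hx' Hfx Hfx').
- intros w w' Hw Hw'; destruct (Hpsi w Hw) as [_ [y [Hy Hgy]]].
  destruct (Hpsi w' Hw') as [_ [y' [Hy' Hgy']]].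
  exact (dilation_limit_lipschitz U n m Y X g L y y' _ _ _ _
    HU HL Hg Hy Hy' Hgy Hgy').
Qed.

Theorem mainTheorem5 (m n : nat) (A B : pt -> Prop) :
  semialgebraic m A -> semialgebraic n B ->
  unbounded m A -> unbounded n B ->
  bilip_at_infinity m n A B ->
  forall CA CB : pt -> Prop,
    tangent_cone_at_infinity m A CA ->
    tangent_cone_at_infinity n B CB ->
    bilip_homeomorphic m n CA CB.
Proof.
intros sA sB uA uB [K [K' [cK [cK' HAB]]]] CA CB HA HB.
exact (asymptotic_cone_bilip m n _ _ CA CB
  (tangent_cone_asymptotic m A K CA sA uA cK HA)
  (tangent_cone_asymptotic n B K' CB sB uB cK' HB) HAB).
Qed.
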